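(* Let $a_1,a_2,\dots,a_k$ be positive integers with $\gcd(a_1,a_2,\dots,a_k)=1$. For every integer $\mu\ge 0$, $$ s_\mu(a_1,\dots,a_k):=\sum_{n\in \mathrm{NR}(a_1,\dots,a_k)}n^\mu =\frac{1}{\mu+1}\sum_{\kappa=0}^{\mu}\binom{\mu+1}{\kappa}B_{\kappa}\,a_1^{\kappa-1}\sum_{i=1}^{a_1-1}m_i^{\mu+1-\kappa} +\frac{B_{\mu+1}}{\mu+1}\bigl(a_1^{\mu+1}-1\bigr). $$
   Context: $\mathrm{R}(a_1,\dots,a_k)$ denotes the set of positive integers that can be written as a nonnegative integer combination of $a_1,\dots,a_k$, and $\mathrm{NR}(a_1,\dots,a_k)$ denotes the (finite) set of positive integers that cannot be so written. For each integer $i$ with $1\le i\le a_1-1$, $m_i$ is the least positive integer with $m_i\equiv i\pmod{a_1}$ and $m_i\in \mathrm{R}(a_1,\dots,a_k)$. The Bernoulli numbers $B_n$ are defined by $\frac{x}{e^x-1}=\sum_{n=0}^\infty B_n\frac{x^n}{n!}$ (so $B_1=-\frac12$). *)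

(* Defs.v *)
From HB Require Import structures.
From mathcomp Require Import all_boot all_order all_algebra.
From mathcomp Require Import mathcomp_extra boolp classical_sets functions.
From mathcomp Require Import cardinality fsbigop.

Set Implicit Arguments.
Unset Strict Implicit.
Unset Printing Implicit Defensive.

Import Order.TTheory GRing.Theory Num.Theory.

Local Open Scope classical_set_scope.
Local Open Scope ring_scope.

(* A nonempty list a_1, ..., a_k of naturals is a function on 'I_k.+1 (k here  *)
(* being one less than the length), so that a_1 is [a ord0].                   *)

Definition R (k : nat) (a : 'I_k.+1 -> nat) : set nat :=
  [set n | (0 < n)%N /\
           exists c : 'I_k.+1 -> nat, n = (\sum_(i < k.+1) c i * a i)%N].

Definition NR (k : nat) (a : 'I_k.+1 -> nat) : set nat :=
  [set n | (0 < n)%N /\ ~ R a n].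

(* The default value 0 is never reached when the a_i are positive and coprime  *)
(* (lemma [min_residueP]).                                                     *)
Definition min_residue (k : nat) (a : 'I_k.+1 -> nat) (i : nat) : nat :=
  let A := [set n | (n = i %[mod a ord0])%N /\ R a n] in
  xget 0%N [set n | A n /\ forall n', A n' -> (n <= n')%N].

(* Formal power series over the rationals, as coefficient sequences.           *)
Definition fps_mul (f g : nat -> rat) : nat -> rat :=
  fun n => \sum_(i < n.+1) f i * g (n - i)%N.

Definition fps_X : nat -> rat := fun n => (n == 1)%:R.

Definition fps_exp_sub1 : nat -> rat :=
  fun n => n`!%:R^-1 - (n == 0)%:R.

Definition fps_egf (B : nat -> rat) : nat -> rat := fun n => B n / n`!%:R.

(* x / (e^x - 1) = \sum_n B_n x^n / n!, the quotient being characterized by    *)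
(* its product with e^x - 1; existence is [bernoulli_gen], uniqueness is       *)
(* [bernoulli_unique].                                                         *)
Definition bernoulli : nat -> rat :=
  xget (fun=> 0)
    [set B : nat -> rat | fps_mul (fps_egf B) fps_exp_sub1 = fps_X].

Section Representability.
Variables (k : nat) (a : 'I_k.+1 -> nat).
Hypothesis a_gt0 : forall i, (0 < a i)%N.
Hypothesis a_gcd : (\big[gcdn/0]_(i < k.+1) a i = 1)%N.

Let C n := exists c : 'I_k.+1 -> nat, n = (\sum_(i < k.+1) c i * a i)%N.

Let CD m n : C m -> C n -> C (m + n)%N.
Proof.
move=> [c ->] [d ->]; exists (fun i => c i + d i)%N.
by rewrite -big_split /=; apply: eq_bigr => i _; rewrite mulnDl.
Qed.

Let CM m n : C n -> C (m * n)%N.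
Proof.
move=> [c ->]; exists (fun i => m * c i)%N.
by rewrite big_distrr /=; apply: eq_bigr => i _; rewrite mulnA.
Qed.

Let Ca i : C (a i).
Proof.
exists (fun j => (j == i)%N : nat); rewrite (bigD1 i) //= eqxx mul1n.
by rewrite big1 ?addn0 // => j /negbTE ->.
Qed.

Let C0 : C 0%N.
Proof. by exists (fun=> 0)%N; rewrite big1. Qed.

Let Cmod d := exists2 n, C n & (n = d %[mod a ord0])%N.

Let Cmod_gcd x y : Cmod x -> Cmod y -> Cmod (gcdn x y).
Proof.
have [->|x_gt0] := posnP x; first by rewrite gcd0n.
move=> [x' Cx' ex] [y' Cy' ey]; case: (egcdnP y x_gt0) => km kn e _.
exists (km * x' + (a ord0).-1 * kn * y')%N; first by apply: CD; exact: CM.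
have -> : (km * x' + (a ord0).-1 * kn * y' =
           km * x + (a ord0).-1 * kn * y %[mod a ord0])%N.
  by rewrite -modnDm -modnMmr ex modnMmr -[X in (_ + X)%N]modnMmr ey modnMmr
             modnDm.
by rewrite e addnAC -mulnA -mulSn prednK // mulnC modnMDl.
Qed.

Lemma residue_R i : exists2 n, R a n & (n = i %[mod a ord0])%N.
Proof.
have [n Cn en] : Cmod 1.
  rewrite -a_gcd; elim/big_ind: _ => [|x y|j _]; [by exists 0%N| |].
    exact: Cmod_gcd.
  by exists (a j).
exists (i * n + a ord0)%N.
  by split; [rewrite addn_gt0 a_gt0 orbT | apply: CD; [exact: CM | exact: Ca]].
by rewrite modnDr -modnMmr en modnMmr muln1.
Qed.

Lemma min_residueP i :
  [/\ R a (min_residue a i), (min_residue a i = i %[mod a ord0])%N &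
      forall n, R a n -> (n = i %[mod a ord0])%N -> (min_residue a i <= n)%N].
Proof.
pose A := [set n | (n = i %[mod a ord0])%N /\ R a n].
have exA : exists n, `[< A n >].
  by have [n Rn en] := residue_R i; exists n; apply/asboolP.
have [[? ?] mP] : A (min_residue a i) /\
    forall n, A n -> (min_residue a i <= n)%N.
  apply: (@xgetPex _ 0%N [set n | A n /\ forall n', A n' -> (n <= n')%N]).
  case: (ex_minnP exA) => m /asboolP Am mP; exists m; split => // n' An'.
  by apply: mP; apply/asboolP.
by split=> // n Rn en; apply: mP.
Qed.

(* Without this, [\sum_(n \in NR a) _] could be the default value 0.            *)
Lemma finite_NR : finite_set (NR a).
Proof.
pose N := (\max_(i < a ord0) min_residue a i)%N.
apply: (@sub_finite_set _ _ (`I_N)); last exact: finite_II.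
move=> n [n_gt0 nRn] /=; rewrite ltnNge; apply/negP => leNn.
have [[_ Cm] em _] := min_residueP (n %% a ord0)%N.
have lem : (min_residue a (n %% a ord0) <= n)%N.
  apply: leq_trans leNn.
  by have := @leq_bigmax _ (fun i : 'I_(a ord0) => min_residue a i)
    (Ordinal (ltn_pmod n (a_gt0 ord0))).
apply: nRn; split=> //; rewrite modn_mod in em.
move/esym/eqP: em; rewrite eqn_mod_dvd // => /dvdnP[q e].
by rewrite -(subnK lem) e; apply: CD => //; apply: CM; exact: Ca.
Qed.

End Representability.

Section Bernoulli.

Let g n : rat := n.+1`!%:R^-1.

Let fact_neq0 n : n`!%:R != 0 :> rat.
Proof. by rewrite pnatr_eq0 -lt0n fact_gt0. Qed.

Let fps_mul_expS (f : nat -> rat) n :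
  fps_mul f fps_exp_sub1 n.+1 = fps_mul f g n.
Proof.
rewrite /fps_mul big_ord_recr /= subnn /fps_exp_sub1 fact0 invr1 subrr mulr0.
rewrite addr0; apply: eq_bigr => i _; rewrite /g subSn; last first.
  by rewrite -ltnS.
by rewrite /= subr0.
Qed.

Let fps_mul_exp0 (f : nat -> rat) : fps_mul f fps_exp_sub1 0 = 0.
Proof.
by rewrite /fps_mul big_ord1 /fps_exp_sub1 fact0 invr1 subrr mulr0.
Qed.

Let fps_mul_g (f : nat -> rat) n :
  fps_mul f g n = \sum_(i < n) f i * g (n - i)%N + f n.
Proof. by rewrite /fps_mul big_ord_recr /= subnn /g invr1 mulr1. Qed.

Let genP (f : nat -> rat) : fps_mul f fps_exp_sub1 = fps_X <->
  forall n, f n = (n == 0)%:R - \sum_(i < n) f i * g (n - i)%N.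
Proof.
split=> [e n|e].
  have /(congr1 (fun h => h n.+1)) := e.
  by rewrite /= fps_mul_expS fps_mul_g /fps_X eqSS => <-; rewrite addrC addKr.
apply/funext => -[|n]; first exact: fps_mul_exp0.
by rewrite fps_mul_expS fps_mul_g [in X in _ + X]e addrC subrK /fps_X eqSS.
Qed.

Let egf_inj B B' : fps_egf B = fps_egf B' -> B = B'.
Proof.
move=> e; apply/funext => n; have /(congr1 (fun h => h n)) := e.
by move/(mulIf (invr_neq0 (fact_neq0 n))).
Qed.

Lemma bernoulli_gen : fps_mul (fps_egf bernoulli) fps_exp_sub1 = fps_X.
Proof.
apply: (@xgetPex _ (fun=> 0)
  [set B : nat -> rat | fps_mul (fps_egf B) fps_exp_sub1 = fps_X]).
pose next (s : seq rat) n := (n == 0)%:R - \sum_(i < n) s`_i * g (n - i)%N.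
pose pre := fix pre n := if n is m.+1 then rcons (pre m) (next (pre m) m)
  else [::].
have size_pre n : size (pre n) = n by elim: n => //= n IH; rewrite size_rcons IH.
have preE n i : (i < n)%N -> (pre n)`_i = next (pre i) i.
  elim: n => // n IH; rewrite ltnS leq_eqVlt /= nth_rcons size_pre.
  by case/predU1P => [->|lt_in]; [rewrite ltnn eqxx | rewrite lt_in IH].
exists (fun n => next (pre n) n * n`!%:R) => /=.
have -> : fps_egf (fun n => next (pre n) n * n`!%:R) = fun n => next (pre n) n.
  by apply/funext => n; rewrite /fps_egf mulfK.
apply/genP => n; rewrite {1}/next; congr (_ - _).
by apply: eq_bigr => i _; rewrite preE.
Qed.

Lemma bernoulli_unique B :
  fps_mul (fps_egf B) fps_exp_sub1 = fps_X -> B = bernoulli.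
Proof.
move=> /genP eB; have /genP eb := bernoulli_gen.
apply: egf_inj; apply/funext => n; elim/ltn_ind: n => n IH.
by rewrite eB eb; congr (_ - _); apply: eq_bigr => i _; rewrite IH.
Qed.

Lemma bernoulli1 : bernoulli 1 = - 2%:R^-1.
Proof.
have /genP e := bernoulli_gen.
have e0 := e 0; have := e 1; rewrite big_ord1 e0 big_ord0 /fps_egf /g.
by rewrite divr1 sub0r subr0 mul1r.
Qed.

End Bernoulli.

(* Main.v *)
Require Import Defs.
From mathcomp Require Import all_boot all_order all_algebra.
From mathcomp Require Import classical_sets fsbigop.
From mathcomp Require Import ring.
Import GRing.Theory Num.Theory.
Local Open Scope ring_scope.

(** Write A for a_1.  A positive integer n congruent to i mod A is
    representable exactly when n >= m_i: by minimality in one direction, and in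
    the other because adding multiples of A to m_i preserves representability.
    Multiples of A are always representable.  So the nonrepresentable integers
    are the disjoint union, over 0 < i < A, of the arithmetic progressions
    i, i + A, ..., m_i - A ([NR_gaps]).

    Power sums along a progression of step A telescope with the help of the
    homogenized Bernoulli polynomial
      P_n(x) = \sum_(k <= n) C(n, k) B_k A^k x^(n - k) = A^n B_n(x / A),
    which satisfies P_n(x + A) - P_n(x) = n A x^(n - 1)
    ([bernoulli_poly_shift]).  Hence, with n = mu + 1,
      A n s_mu = \sum_(0 < i < A) P_n(m_i) - \sum_(0 < i < A) P_n(i)
    ([sum_NR_pow]).  The terms k < n of the P_n(m_i) give the double sum of the
    formula.  The second sum is known in closed form from Raabe's
    multiplication formula \sum_(0 <= i < A) P_n(i) = A B_n
    ([sum_bernoulli_poly]); together with the terms k = n of the P_n(m_i) it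
    gives the last summand of the formula. *)

(** * Homogenized Bernoulli polynomials *)

(** The coefficient of x^n in B(x) (e^x - 1) = x, multiplied by n!. *)
Lemma bernoulli_rec (n : nat) :
  \sum_(i < n) 'C(n, i)%:R * bernoulli i = (n == 1)%:R.
Proof.
have factU m : m`!%:R != 0 :> rat by rewrite pnatr_eq0 -lt0n fact_gt0.
have /(congr1 (fun f => n`!%:R * f n)) := bernoulli_gen.
rewrite /fps_mul /fps_X /= big_ord_recr /= subnn /fps_exp_sub1 fact0 invr1.
rewrite subrr mulr0 addr0 mulr_sumr => e.
transitivity (n`!%:R * (n == 1)%:R : rat); last first.
  by case: eqP => [->|_]; rewrite ?mulr1 ?mulr0.
rewrite -e; apply: eq_bigr => i _.
rewrite /fps_egf subn_eq0 leqNgt ltn_ord subr0.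
rewrite -(bin_fact (ltnW (ltn_ord i))) !natrM.
by field; rewrite !factU.
Qed.

(** This is h^n B_n(x / h).  The homogeneous form has no division, and its
    difference equation has step h, which may be taken equal to a_1. *)
Definition bernoulli_poly (h : rat) (n : nat) : {poly rat} :=
  \sum_(i < n.+1) ('C(n, i)%:R * bernoulli i * h ^+ i) *: 'X^(n - i).

Lemma horner_bernoulli_poly (h : rat) (n : nat) (x : rat) :
  (bernoulli_poly h n).[x] =
  \sum_(i < n) 'C(n, i)%:R * bernoulli i * h ^+ i * x ^+ (n - i)
  + bernoulli n * h ^+ n.
Proof.
rewrite horner_sum big_ord_recr /= subnn binn mul1r hornerZ hornerXn mulr1.
by congr (_ + _); apply: eq_bigr => i _; rewrite hornerZ hornerXn.
Qed.

Lemma horner0_bernoulli_poly (h : rat) (n : nat) :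
  (bernoulli_poly h n).[0] = bernoulli n * h ^+ n.
Proof.
rewrite horner_bernoulli_poly big1 ?add0r // => i _.
by rewrite expr0n subn_eq0 leqNgt ltn_ord mulr0.
Qed.

Lemma deriv_bernoulli_poly (h : rat) (n : nat) :
  (bernoulli_poly h n.+1)^`() = n.+1%:R *: bernoulli_poly h n.
Proof.
rewrite /bernoulli_poly big_ord_recr /= subnn expr0 alg_polyC derivD derivC.
rewrite addr0 raddf_sum scaler_sumr; apply: eq_bigr => i _.
have le_in : (i <= n)%N by rewrite -ltnS.
rewrite /= derivZ derivXn subSn // succnK -scaler_nat !scalerA -subSn //.
congr (_ *: _); move: (bernoulli i) (h ^+ i) => b x.
have := congr1 (fun m => m%:R : rat) (mul_bin_down n.+1 i).
by rewrite /= !natrM => e; rewrite !mulrA e; ring.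
Qed.

Lemma deriv_eq0_const (p : {poly rat}) : p^`() = 0 -> p = (p.[0])%:P.
Proof.
move=> p'0; rewrite horner_coef0; apply/polyP => -[|i]; rewrite coefC //=.
have /(congr1 (fun q : {poly rat} => q`_i)) := p'0.
by rewrite coef_deriv coef0 => /eqP; rewrite mulrn_eq0 /= => /eqP.
Qed.

(** By induction on the degree: the derivative of the identity in degree n + 1
    is n + 1 times the identity in degree n, so both sides differ by a
    constant, and at 0 they agree by the recurrence for Bernoulli numbers. *)
Lemma bernoulli_poly_shift (h : rat) (n : nat) :
  bernoulli_poly h n \Po ('X + h%:P) - bernoulli_poly h n =
  (h * n%:R) *: 'X^(n.-1).
Proof.
elim: n => [|n IH].
  rewrite mulr0 scale0r /bernoulli_poly big_ord1 subnn expr0 alg_polyC.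
  by rewrite comp_polyC subrr.
apply/eqP; rewrite -subr_eq0; set p := (X in X == 0).
have p'0 : p^`() = 0.
  rewrite /p !derivB deriv_comp derivD derivX derivC addr0 mulr1 derivZ derivXn.
  rewrite deriv_bernoulli_poly comp_polyZ -scalerBr IH -scaler_nat !scalerA.
  by apply/eqP; rewrite subr_eq0 /=; apply/eqP; congr (_ *: _); ring.
rewrite (deriv_eq0_const _ p'0) /p !hornerE horner_comp !hornerE.
rewrite horner0_bernoulli_poly horner_bernoulli_poly addrK /=.
have -> : \sum_(i < n.+1) 'C(n.+1, i)%:R * bernoulli i * h ^+ i * h ^+ (n.+1 - i)
   = h ^+ n.+1 * \sum_(i < n.+1) 'C(n.+1, i)%:R * bernoulli i.
  rewrite mulr_sumr; apply: eq_bigr => i _.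
  by rewrite -mulrA -exprD subnKC 1?mulrC // ltnW.
rewrite bernoulli_rec expr0n eqSS; case: n {IH p p'0} => [|n] /=.
  by rewrite expr1 !mulr1 subrr.
by rewrite !mulr0 subrr.
Qed.

(** A 1-periodic polynomial takes its value at 0 at every natural number,
    hence infinitely often. *)
Lemma periodic_const (p : {poly rat}) : p \Po ('X + 1) = p -> p = (p.[0])%:P.
Proof.
move=> pP; pose q := p - (p.[0])%:P.
have pn n : p.[n%:R] = p.[0].
  elim: n => // n <-; rewrite -{2}pP horner_comp !hornerE.
  by congr (_.[_]); ring.
apply/eqP; rewrite -subr_eq0 -/q; apply/contraT => q0.
have := @max_poly_roots _ q [seq i%:R | i <- iota 0 (size q)] q0.
rewrite size_map size_iota ltnn; apply.
  by apply/allP => _ /mapP[i _ ->]; rewrite /root !hornerE pn subrr.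
by rewrite map_inj_uniq ?iota_uniq // => i j /eqP; rewrite eqr_nat => /eqP.
Qed.

(** Raabe's multiplication formula.  Under x -> x + 1 the left-hand side
    telescopes, and it has the same difference as the right-hand side.  In
    degree n + 1 the two sides thus differ by a periodic polynomial, that is, by
    a constant; differentiating removes the constant and descends to
    degree n. *)
Lemma bernoulli_poly_mul (A n : nat) :
  \sum_(0 <= i < A) (bernoulli_poly A%:R n \Po ('X + (i%:R)%:P)) =
  A%:R *: bernoulli_poly 1 n.
Proof.
pose Q m := \sum_(0 <= i < A) (bernoulli_poly A%:R m \Po ('X + (i%:R)%:P)).
have Q_shift m : Q m \Po ('X + 1) - Q m = (A%:R * m%:R) *: 'X^(m.-1).
  rewrite -bernoulli_poly_shift {2}/Q /Q raddf_sum -sumrB.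
  pose f i := bernoulli_poly A%:R m \Po ('X + (i%:R)%:P).
  rewrite (eq_bigr (fun i => f i.+1 - f i)) => [|i _]; last first.
    rewrite /f /= -comp_polyA comp_polyD comp_polyX comp_polyC.
    by rewrite -addrA -polyC1 -polyCD nat1r.
  by rewrite telescope_sumr // /f addr0 comp_polyXr.
pose p := Q n.+1 - A%:R *: bernoulli_poly 1 n.+1.
have /periodic_const p_const : p \Po ('X + 1) = p.
  apply/eqP; rewrite -subr_eq0 /p comp_polyB comp_polyZ.
  have -> (x y u v : {poly rat}) : x - y - (u - v) = x - u - (y - v) by ring.
  have := bernoulli_poly_shift 1 n.+1; rewrite polyC1 mul1r => P_shift.
  by rewrite Q_shift -scalerBr P_shift scalerA subrr.
have Q' : (Q n.+1)^`() = n.+1%:R *: Q n.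
  rewrite raddf_sum scaler_sumr; apply: eq_bigr => i _.
  rewrite /= deriv_comp derivD derivX derivC addr0 mulr1.
  by rewrite deriv_bernoulli_poly comp_polyZ.
have /eqP : p^`() = 0 by rewrite p_const derivC.
rewrite derivB Q' derivZ deriv_bernoulli_poly scalerA mulrC -scalerA -scalerBr.
by rewrite scaler_eq0 pnatr_eq0 /= subr_eq0 => /eqP.
Qed.

Lemma sum_bernoulli_poly (A n : nat) :
  \sum_(0 <= i < A) (bernoulli_poly A%:R n).[i%:R] = A%:R * bernoulli n.
Proof.
have /(congr1 (fun p : {poly rat} => p.[0])) := bernoulli_poly_mul A n.
rewrite horner_sum hornerZ horner0_bernoulli_poly expr1n mulr1 => <-.
by apply: eq_bigr => i _; rewrite horner_comp !hornerE.
Qed.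

Lemma sum_arith_prog_pow (A q i n : nat) :
  A%:R * n.+1%:R * \sum_(0 <= j < q) ((i + j * A)%:R : rat) ^+ n =
  (bernoulli_poly A%:R n.+1).[(i + q * A)%:R] -
  (bernoulli_poly A%:R n.+1).[i%:R].
Proof.
pose f j := (bernoulli_poly A%:R n.+1).[(i + j * A)%:R].
rewrite mulr_sumr (eq_bigr (fun j => f j.+1 - f j)) => [|j _].
  by rewrite telescope_sumr // /f mul0n addn0.
have := congr1 (fun p : {poly rat} => p.[(i + j * A)%:R])
  (bernoulli_poly_shift A%:R n.+1).
rewrite hornerD hornerN horner_comp !hornerE /= => <-.
by rewrite /f -natrD -addnA [(j * A + A)%N]addnC -mulSn.
Qed.

(** * The nonrepresentable integers *)

Section Gaps.
Variables (k : nat) (a : 'I_k.+1 -> nat).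
Hypothesis a_gt0 : forall i, (0 < a i)%N.
Hypothesis a_gcd : \big[gcdn/0%N]_(i < k.+1) a i = 1%N.

Lemma R_add_mul (n t : nat) : R a n -> R a (n + t * a ord0)%N.
Proof.
move=> [n_gt0 [c nE]]; split; first by rewrite addn_gt0 n_gt0.
exists (fun i => c i + t * (i == ord0))%N.
under eq_bigr do rewrite mulnDl.
rewrite big_split /= -nE; congr addn; rewrite (bigD1 ord0) //= muln1.
by rewrite big1 ?addn0 // => i /negbTE ->; rewrite muln0.
Qed.

Lemma R_mul (t : nat) : (0 < t)%N -> R a (t * a ord0)%N.
Proof.
move=> t_gt0; split; first by rewrite muln_gt0 t_gt0 a_gt0.
exists (fun i => t * (i == ord0))%N; rewrite (bigD1 ord0) //= muln1.
by rewrite big1 ?addn0 // => i /negbTE ->; rewrite muln0.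
Qed.

(** The quotient of m_i by a_1 is the number of nonrepresentable integers
    congruent to i, since m_i has remainder i. *)
Lemma NR_progressionP (i j : nat) : (0 < i < a ord0)%N ->
  NR a (i + j * a ord0)%N <-> (j < min_residue a i %/ a ord0)%N.
Proof.
move=> /andP[i_gt0 iA].
have [Rm em m_min] := min_residueP a_gt0 a_gcd i.
have mE := divn_eq (min_residue a i) (a ord0).
rewrite em (modn_small iA) in mE.
set q := (_ %/ _)%N in mE *; split => [[_ nR]|jq].
  rewrite ltnNge; apply/negP => qj; apply: nR.
  rewrite -(subnKC qj) mulnDl addnA [(i + _)%N]addnC -mE.
  exact: R_add_mul.
split=> [|Rn]; first by rewrite addn_gt0 i_gt0.
have := m_min _ Rn; rewrite addnC modnMDl => /(_ erefl).
by rewrite mE leq_add2r leq_pmul2r // leqNgt jq.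
Qed.

Definition gaps : seq nat :=
  [seq (i + j * a ord0)%N | i <- index_iota 1 (a ord0),
                        j <- index_iota 0 (min_residue a i %/ a ord0)].

Lemma gaps_uniq : uniq gaps.
Proof.
apply: allpairs_uniq_dep => [|i _|]; rewrite ?iota_uniq //.
move=> [i j] [i' j'] /allpairsPdep[x [y [xI _ [-> ->]]]].
move=> /allpairsPdep[x' [y' [x'I _ [-> ->]]]] /= e.
move: xI x'I; rewrite !mem_index_iota => /andP[_ xA] /andP[_ x'A].
have ex : x = x'.
  by move/(congr1 (modn^~ (a ord0))): e; rewrite /= ![(_ + _ * _)%N]addnC !modnMDl !modn_small.
by move/eqP: e; rewrite ex eqn_add2l eqn_pmul2r // => /eqP ->.
Qed.

Lemma NR_gaps : NR a = [set` gaps]%classic.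
Proof.
apply/seteqP; split=> n /=.
  move=> NRn; have nE := divn_eq n (a ord0); rewrite addnC in nE.
  have rA : (n %% a ord0 < a ord0)%N by rewrite ltn_pmod.
  have r_gt0 : (0 < n %% a ord0)%N.
    rewrite lt0n; apply/eqP => r0; case: NRn => n_gt0; apply.
    rewrite nE r0 add0n; apply: R_mul.
    by move: n_gt0; rewrite {1}nE r0 add0n muln_gt0 => /andP[].
  apply/allpairsPdep; exists (n %% a ord0)%N, (n %/ a ord0)%N.
  rewrite !mem_index_iota r_gt0 rA; split=> //=.
  by apply/NR_progressionP; rewrite ?r_gt0 -?nE.
move=> /allpairsPdep[i [j [iI jI ->]]]; rewrite !mem_index_iota in iI jI.
exact/NR_progressionP.
Qed.

Lemma sum_NR_pow (n : nat) :
  (a ord0)%:R * n.+1%:R * (\sum_(x \in NR a) (x%:R : rat) ^+ n) =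
  \sum_(1 <= i < a ord0) ((bernoulli_poly (a ord0)%:R n.+1).[(min_residue a i)%:R] -
                          (bernoulli_poly (a ord0)%:R n.+1).[i%:R]).
Proof.
rewrite NR_gaps -fsbig_seq ?gaps_uniq // big_allpairs_dep /= mulr_sumr.
apply: eq_big_nat => i /andP[_ iA].
have [_ em _] := min_residueP a_gt0 a_gcd i.
have := divn_eq (min_residue a i) (a ord0); rewrite em modn_small // addnC.
by rewrite sum_arith_prog_pow => <-.
Qed.

End Gaps.

(** * The power sum formula *)

Theorem theorem1 (k : nat) (a : 'I_k.+1 -> nat) :
  (forall i, (0 < a i)%N) ->
  \big[gcdn/0%N]_(i < k.+1) a i = 1%N ->
  forall mu : nat,
    \sum_(n \in NR a) (n%:R : rat) ^+ mu =
      (mu.+1)%:R^-1 *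
        \sum_(0 <= kappa < mu.+1)
          ('C(mu.+1, kappa)%:R * bernoulli kappa *
           ((a ord0)%:R : rat) ^ (kappa%:Z - 1) *
           \sum_(1 <= i < a ord0) (min_residue a i)%:R ^+ (mu.+1 - kappa))
      + bernoulli mu.+1 / (mu.+1)%:R * ((a ord0)%:R ^+ mu.+1 - 1).
Proof.
move=> a_gt0 a_gcd mu.
have A0 : (a ord0)%:R != 0 :> rat by rewrite pnatr_eq0 -lt0n.
have mu0 : mu.+1%:R != 0 :> rat by rewrite pnatr_eq0.
have := sum_NR_pow k a a_gt0 a_gcd mu.
have := sum_bernoulli_poly (a ord0) mu.+1.
rewrite big_ltn // horner0_bernoulli_poly sumrB => sumP.
set s := (\sum_(n \in _) _); set P := \sum_(1 <= i < _) _ in sumP *.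
set M := \sum_(1 <= i < _) _ => sE.
set T := \sum_(0 <= kappa < _) _.
(* Separate the constant term of the polynomial, which does not depend on the
   residue, from the terms that form the double sum. *)
have TE : M = (a ord0)%:R * T +
              (bernoulli mu.+1 * (a ord0)%:R ^+ mu.+1) *+ (a ord0).-1.
  rewrite /M; under eq_bigr do rewrite horner_bernoulli_poly.
  rewrite big_split /= sumr_const_nat subn1; congr (_ + _).
  rewrite exchange_big /T big_mkord mulr_sumr /=; apply: eq_bigr => j _.
  by rewrite -mulr_sumr expfzDr // exprN1 -exprnP; field.
have pE : (a ord0).-1%:R = (a ord0)%:R - 1 :> rat.
  by rewrite -[in RHS](prednK (a_gt0 ord0)) -natr1 addrK.
apply: (mulfI (mulf_neq0 A0 mu0)); rewrite sE TE -[_ *+ (a ord0).-1]mulr_natr pE.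
have -> : P = (a ord0)%:R * bernoulli mu.+1 -
              bernoulli mu.+1 * (a ord0)%:R ^+ mu.+1.
  by rewrite -sumP [X in X - _]addrC addrK.
by field; rewrite nat1r.
Qed.
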